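(* (Hermite-Hadamard inequality) Let $a<b$ be real numbers and let $f : [a,b] \to X$ be a uniformly differentiable and convex function. Then $$f\Bigl( \dfrac{a+b}{2} \Bigr) \leq \dfrac{1}{b-a} \int_a^b f(t)\, d\mu(t) \leq \dfrac{f(a)+f(b)}{2},$$ where $\mu$ is the Lebesgue measure on $[a,b]$.
   Context: Setting. $X$ is a Dedekind complete vector lattice with an order unit $e$ (for every $x\in X$ there is a real $c>0$ with $|x|\le c e$). By the Maeda-Ogasawara-Vulikh theorem $X$ is lattice isomorphic to $C(\Omega)$, $\Omega$ compact and extremely disconnected, with $e$ corresponding to the constant function $1$; $X$ carries the corresponding pointwise multiplication, so it is a commutative $f$-algebra with unit $e$. $X^+$ denotes the set of elements $x\ge 0$, $x\neq 0$, and $\mathbb{R}^+=]0,+\infty[$. An $(o)$-sequence (in $X$ or $\mathbb{R}$) is a decreasing sequence with infimum $0$. Uniform differentiability: $f:[a,b]\to X$ is uniformly differentiable iff there are a bounded $g:[a,b]\to X$ (the uniform derivative of $f$) and $(o)$-sequences $(\sigma_p)_p$ in $X$, $(\delta_p)_p$ in $\mathbb{R}^+$ with $$\bigvee\Bigl\{\Bigl|\frac{f(v)-f(u)}{v-u}-g(x)\Bigr|:u\le x\le v,\ 0<v-u\le\delta_p\Bigr\}\le\sigma_p e\quad\text{for every }p\in\mathbb{N},$$ where $u,x,v\in[a,b]$. Convexity: $f:[a,b]\to X$ is convex iff $f(t)\le f(t_1)+\frac{f(t_2)-f(t_1)}{t_2-t_1}(t-t_1)$ whenever $t_1<t<t_2$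 are in $[a,b]$. Integral: put $G=[a,b]$, $\mathcal{A}$ the Lebesgue measurable subsets of $G$, $\mu$ the Lebesgue measure, $\mathcal{A}_b=\{B\in\mathcal{A}:\mu(B)<+\infty\}$, and let $\mathcal{F}$ be a fixed free filter of $\mathbb{N}$, i.e. a filter of subsets of $\mathbb{N}$ (not containing $\emptyset$) containing all cofinite sets. $(o_{\mathcal F})\lim_n x_n=x$ in $X$ means that there is an $(o)$-sequence $(\sigma_p)_p$ in $X$ with $\{n:|x_n-x|\le\sigma_p\}\in\mathcal{F}$ for every $p$. A function $f:G\to X$ is simple iff it has finite range and $f^{-1}(\{x\})\in\mathcal{A}$ for every $x\in X$. $L^*$ is the set of simple functions vanishing outside a set of finite measure; for $f=\sum_i c_i 1_{E_i}\in L^*$ (with the $E_i\in\mathcal{A}_b$ pairwise disjoint), $\int_G f\,d\mu=\sum_i c_i\mu(E_i)$ and $\int_A f\,d\mu=\int_G f1_A\,d\mu$ for $A\in\mathcal{A}$. Put $\iota(f)=\int_G|f|\,d\mu$ for $f\in L^*$. A sequence $(f_n)_n$ in $X^G$ $\mu$-converges to $f\in X^G$ iff there are $(o)$-sequences $(\varepsilon_p)_p$, $(\sigma_p)_p$ in $\mathbb{R}^+$ and sets $A_n^p\in\mathcal{A}$ with $A_n^p\supset\{t\in G:|f_n(t)-f(t)|\not\le\varepsilon_p e\}$ for all $n,p$ and $\{n:\mu(A_n^p)\le\sigma_p\}\in\mathcal{F}$ for all $p$. A sequence $(f_n)_n$ in $L^*$ is equi-absolutely continuous iff there is a real $\alpha>0$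 such that: (1) for every $(o)$-sequence $(\sigma_p)_p$ in $\mathbb{R}^+$ there are an $(o)$-sequence $(w_p)_p$ in $X^+$ and sets $\Lambda^p\in\mathcal{F}$ with $\iota(\alpha f_n1_B)\le w_p$ whenever $n\in\Lambda^p$, $B\in\mathcal{A}$, $\mu(B)\le\sigma_p$; (2) there are an $(o)$-sequence $(r_m)_m$ in $X^+$ and sets $B_m\in\mathcal{A}_b$ with $\{n:\iota(\alpha f_n1_{G\setminus B_m})\le r_m\}\in\mathcal{F}$ for every $m$. A positive $f:G\to X$ is integrable iff there are an equi-absolutely continuous sequence $(f_n)_n$ in $L^*$, $\mu$-convergent to $f$, and a map $l:\mathcal{A}\to X$ with $(o_{\mathcal F})\lim_n\bigvee_{A\in\mathcal{A}}|\int_A f_n\,d\mu-l(A)|=0$; then $\int_A f\,d\mu:=l(A)$ (independent of the sequence). A general $f:G\to X$ is integrable iff $f\vee0$ and $(-f)\vee0$ are, and its integral is the difference of the two integrals. $\int_a^b f\,d\mu$ means $\int_{[a,b]}f\,d\mu$. The claim includes that the integral exists. *)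

(* Defs.v *)
From HB Require Import structures.
From mathcomp Require Import all_boot all_order all_algebra.
From mathcomp Require Import all_classical all_reals all_analysis.

Set Implicit Arguments.
Unset Strict Implicit.
Unset Printing Implicit Defensive.

Import Order.TTheory GRing.Theory Num.Theory.

Local Open Scope classical_set_scope.
Local Open Scope ring_scope.

(* The hierarchies of lattices and of Z-modules have no join in MathComp other
   than the ordered rings, so the binary supremum is an operation of the mixin
   over the partially ordered left modules. *)
HB.mixin Record isVectorLattice (R : realType) X
    of GRing.Lmodule R X & Num.POrderedZmodule X := {
  vsup : X -> X -> X ;
  vsup_le : forall x y z : X, (vsup x y <= z) = (x <= z) && (y <= z) ;
  vlat_lerD2r : forall z x y : X, x <= y -> x + z <= y + z ;
  vlat_scaler_ge0 : forall (c : R) (x : X), 0 <= c -> 0 <= x -> 0 <= c *: x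
}.

#[short(type="vectorLatticeType")]
HB.structure Definition VectorLattice (R : realType) :=
  { X of GRing.Lmodule R X & Num.POrderedZmodule X & isVectorLattice R X }.

Definition vinf (R : realType) (X : vectorLatticeType R) (x y : X) : X :=
  - vsup (- x) (- y).

Definition vabs (R : realType) (X : vectorLatticeType R) (x : X) : X :=
  vsup x (- x).

HB.mixin Record isDedekindComplete (R : realType) X of VectorLattice R X := {
  dedekind_complete :
    forall A : set X, A !=set0 -> has_ubound A -> supremums A !=set0
}.

#[short(type="dedekindVectorLatticeType")]
HB.structure Definition DedekindVectorLattice (R : realType) :=
  { X of VectorLattice R X & isDedekindComplete R X }.

(* An order unit vunit, together with the commutative f-algebra multiplication
   whose unit is vunit.  This multiplication is the pointwise one of the
   Maeda-Ogasawara-Vulikh representation X = C(Omega), vunit = 1: it exists in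
   every Dedekind complete vector lattice with an order unit, and an Archimedean
   vector lattice has at most one f-algebra multiplication with a given unit.
   The space X = {0} is excluded. *)
HB.mixin Record hasOrderUnitFAlgebra (R : realType) X
    of DedekindVectorLattice R X := {
  vunit : X ;
  vunit_neq0 : vunit != 0 ;
  order_unitP : forall x : X, exists2 c : R, 0 < c & vabs x <= c *: vunit ;
  vmul : X -> X -> X ;
  vmulA : associative vmul ;
  vmulC : commutative vmul ;
  vmul1l : left_id vunit vmul ;
  vmulDl : left_distributive vmul +%R ;
  vmulZl : forall (c : R) (x y : X), vmul (c *: x) y = c *: vmul x y ;
  vmul_ge0 : forall x y : X, 0 <= x -> 0 <= y -> 0 <= vmul x y ;
  vmul_disjoint : forall x y z : X,
    vinf x y = 0 -> 0 <= z -> vinf (vmul z x) y = 0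
}.

#[short(type="orderUnitFAlgType")]
HB.structure Definition OrderUnitFAlgebra (R : realType) :=
  { X of DedekindVectorLattice R X & hasOrderUnitFAlgebra R X }.

Definition o_sequence (T : porderZmodType) (s : nat -> T) : Prop :=
  nonincreasing_seq s /\ infimums (range s) 0.

(* (o)-sequences in R^+ and in X^+, where 0 is not in R^+ nor in X^+ *)
Definition pos_o_sequence (T : porderZmodType) (s : nat -> T) : Prop :=
  (forall p, 0 < s p) /\ o_sequence s.

Definition free_filter (F : set_system nat) : Prop :=
  ProperFilter F /\ forall A : set nat, finite_set (~` A) -> F A.

Definition oF_lim (R : realType) (X : vectorLatticeType R)
    (F : set_system nat) (x : nat -> X) (l : X) : Prop :=
  exists2 s : nat -> X, o_sequence s &
    forall p, F [set n | vabs (x n - l) <= s p].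

Section differentiability_convexity.
Context (R : realType) (X : orderUnitFAlgType R).
Implicit Types (a b : R) (f g : R -> X).

Definition uniform_derivative a b f g : Prop :=
  (exists M : X, forall x, a <= x <= b -> vabs (g x) <= M) /\
  exists (s : nat -> X) (delta : nat -> R),
    [/\ o_sequence s, pos_o_sequence delta &
      forall p, exists2 S : X,
        supremums [set y : X | exists u x v : R,
            [/\ a <= u, u <= x <= v, v <= b, 0 < v - u <= delta p &
              y = vabs ((v - u)^-1 *: (f v - f u) - g x)]] S &
        S <= vmul (s p) vunit].

Definition uniformly_differentiable a b f : Prop :=
  exists g, uniform_derivative a b f g.

Definition convex_on a b f : Prop :=
  forall t1 t t2 : R, a <= t1 -> t1 < t -> t < t2 -> t2 <= b ->
    f t <= f t1 + (t - t1) *: ((t2 - t1)^-1 *: (f t2 - f t1)).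

End differentiability_convexity.

(* G is a subset of the measurable space T, and functions on G are functions on
   T of which only the values on G matter. *)
Section integral.
Context (R : realType) (X : orderUnitFAlgType R) (F : set_system nat).
Context (d : measure_display) (T : measurableType d).
Context (mu : {measure set T -> \bar R}) (G : set T).
Implicit Types (f : T -> X) (A B : set T).

Definition msub A : Prop := measurable A /\ A `<=` G.

Definition msub_fin A : Prop := msub A /\ (mu A < +oo)%E.

Definition simple f : Prop :=
  finite_set (f @` G) /\ forall x : X, msub (G `&` f @^-1` [set x]).

Definition Lstar f : Prop :=
  simple f /\
  exists2 B, msub_fin B & forall t, G t -> ~ B t -> f t = 0.

(* The term of the value 0, whose preimage may have infinite measure, is 0. *)
Definition simple_integral f : X :=
  \sum_(c \in f @` G) fine (mu (G `&` f @^-1` [set c])) *: c.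

Definition restr f A : T -> X := fun t => (\1_A t : R) *: f t.

Definition iota_int f : X := simple_integral (fun t => vabs (f t)).

Definition mu_converges (fn : nat -> T -> X) f : Prop :=
  exists (eps sigma : nat -> R) (A : nat -> nat -> set T),
    [/\ pos_o_sequence eps, pos_o_sequence sigma,
        (forall n p, msub (A n p)),
        (forall n p, [set t | G t /\ ~ (vabs (fn n t - f t) <= eps p *: vunit)]
                       `<=` A n p) &
        forall p, F [set n | (mu (A n p) <= (sigma p)%:E)%E]].

Definition equi_abs_continuous (fn : nat -> T -> X) : Prop :=
  exists alpha : R,
    [/\ 0 < alpha,
        (forall sigma : nat -> R, pos_o_sequence sigma ->
           exists (w : nat -> X) (Lambda : nat -> set nat),
             [/\ pos_o_sequence w, (forall p, F (Lambda p)) &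
               forall p n B, Lambda p n -> msub B ->
                 (mu B <= (sigma p)%:E)%E ->
                 iota_int (restr (fun t => alpha *: fn n t) B) <= w p]) &
        exists (r : nat -> X) (B : nat -> set T),
          [/\ pos_o_sequence r, (forall m, msub_fin (B m)) &
            forall m, F [set n |
              iota_int (restr (fun t => alpha *: fn n t) (G `\` B m)) <= r m]]].

(* l is the set function A |-> \int_A f; its values matter only on the
   measurable subsets of G. *)
Definition pos_integral f (l : set T -> X) : Prop :=
  (forall t, G t -> 0 <= f t) /\
  exists fn : nat -> T -> X,
    [/\ (forall n, Lstar (fn n)), equi_abs_continuous fn,
        mu_converges fn f &
        exists2 S : nat -> X,
          (forall n, supremums
             [set vabs (simple_integral (restr (fn n) A) - l A) | A in msub]
             (S n)) &
          oF_lim F S 0].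

Definition is_integral f A (I : X) : Prop :=
  exists lp ln : set T -> X,
    [/\ pos_integral (fun t => vsup (f t) 0) lp,
        pos_integral (fun t => vsup (- f t) 0) ln & I = lp A - ln A].

End integral.

(* Main.v *)
Require Import Defs.
From HB Require Import structures.
From mathcomp Require Import all_boot all_order all_algebra.
From mathcomp Require Import all_classical all_reals all_analysis.
From mathcomp Require Import ring lra.

(** Both inequalities hold without error for midpoint Riemann sums, and the
    integral is a limit of such sums.

    A uniformly differentiable function is Lipschitz for the norm of the order
    unit, because its difference quotients over short intervals stay close to a
    bounded derivative ([uniformly_differentiable_lipschitz]); so are its positive
    and negative parts. A positive Lipschitz function is a uniform limit, with
    error of order [1 / n], of the step functions that take its values at the
    midpoints of [n.+1] equal pieces. Such a limit is integrable and its integral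
    is the limit of the integrals of the step functions
    ([pos_integral_uniform_limit]): a common bound by a multiple of the unit gives
    equi-absolute continuity, and Dedekind completeness gives the limits
    ([nested_limit]). This proves existence, with the midpoint sums converging to
    the integral ([pos_integral_lipschitz]).

    The definition of the integral lets the approximating sequence be arbitrary, so
    the bounds for every integral [I] need uniqueness ([pos_integral_unique]). Two
    approximating sequences are uniformly close off a set of small measure, and on
    that set both have small integrals by equi-absolute continuity. The calculus of
    simple functions behind these estimates rests on one change of variables
    ([simple_integral_comp]).

    For the bounds themselves, the nodes of the midpoint rule come in pairs [t] and
    [a + b - t]. Convexity bounds [f t + f (a + b - t)] below by twice the value at
    the centre and above by [f a + f b]. Averaging over the pairs bounds every
    midpoint sum without error ([midpoint_sum_convex]), and the Archimedean
    property carries the bounds to the limit. *)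

Set Implicit Arguments.
Unset Strict Implicit.
Unset Printing Implicit Defensive.

Import Order.TTheory GRing.Theory Num.Theory.

Local Open Scope classical_set_scope.
Local Open Scope ring_scope.

(** * Vector lattices *)
Section vector_lattice.
Context (R : realType) (X : vectorLatticeType R).
Implicit Types (x y z t : X) (c : R).

Lemma vlerD x y z t : x <= y -> z <= t -> x + z <= y + t.
Proof.
move=> xy zt; apply: le_trans (vlat_lerD2r z _ _ xy) _.
by rewrite addrC (addrC y); exact: vlat_lerD2r.
Qed.

Lemma vlerDr x y : 0 <= y -> x <= x + y.
Proof. by move=> y0; rewrite -{1}[x]addr0 vlerD. Qed.

Lemma vaddr_ge0 x y : 0 <= x -> 0 <= y -> 0 <= x + y.
Proof. by move=> x0 y0; rewrite -[0]addr0 vlerD. Qed.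

Lemma vlerBlDr x y z : (x - y <= z) = (x <= z + y).
Proof.
apply/idP/idP => [/(vlat_lerD2r y _ _)|/(vlat_lerD2r (- y) _ _)].
  by rewrite subrK.
by rewrite addrK.
Qed.

Lemma vlerBrDr x y z : (x <= y - z) = (x + z <= y).
Proof. by rewrite -{2}[z]opprK vlerBlDr. Qed.

Lemma vsubr_ge0 x y : (0 <= y - x) = (x <= y).
Proof. by rewrite vlerBrDr add0r. Qed.

Lemma vlerN2 x y : (- x <= - y) = (y <= x).
Proof. by rewrite -[LHS]vsubr_ge0 opprK addrC vsubr_ge0. Qed.

Lemma vlerZ c x y : 0 <= c -> x <= y -> c *: x <= c *: y.
Proof.
by move=> c0 xy; rewrite -vsubr_ge0 -scalerBr vlat_scaler_ge0// vsubr_ge0.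
Qed.

Lemma vlerZr c c' x : 0 <= x -> c <= c' -> c *: x <= c' *: x.
Proof.
by move=> x0 cc'; rewrite -vsubr_ge0 -scalerBl vlat_scaler_ge0// subr_ge0.
Qed.

Lemma vler_sum (I : Type) (r : seq I) (P : pred I) (E E' : I -> X) :
  (forall i, P i -> E i <= E' i) ->
  \sum_(i <- r | P i) E i <= \sum_(i <- r | P i) E' i.
Proof. by move=> EE'; elim/big_ind2 : _ => // *; exact: vlerD. Qed.

Lemma vsup_gel x y : x <= vsup x y.
Proof. by have := lexx (vsup x y); rewrite vsup_le => /andP[]. Qed.

Lemma vsup_ger x y : y <= vsup x y.
Proof. by have := lexx (vsup x y); rewrite vsup_le => /andP[]. Qed.

Lemma vabs_le x y : (vabs x <= y) = (x <= y) && (- x <= y).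
Proof. exact: vsup_le. Qed.

Lemma vle_abs x : x <= vabs x. Proof. exact: vsup_gel. Qed.

Lemma vleN_abs x : - x <= vabs x. Proof. exact: vsup_ger. Qed.

Lemma vabs_ge0 x : 0 <= vabs x.
Proof.
have h : 0 <= vabs x + vabs x by rewrite -(subrr x) vlerD ?vle_abs ?vleN_abs.
have : 0 <= 2^-1 *: (vabs x + vabs x) by rewrite vlat_scaler_ge0.
by rewrite scalerDr -scalerDl -[2^-1]div1r -splitr scale1r.
Qed.

Lemma vabsN x : vabs (- x) = vabs x.
Proof.
apply: le_anti.
rewrite !vabs_le opprK !(vle_abs, vleN_abs) -{1}(opprK x).
by rewrite !(vle_abs, vleN_abs).
Qed.

Lemma vabs_id x : 0 <= x -> vabs x = x.
Proof.
move=> x0; apply: le_anti; rewrite vabs_le lexx vle_abs/= andbT.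
by rewrite (le_trans _ x0)// -oppr0 vlerN2.
Qed.

Lemma vabs0 : vabs (0 : X) = 0.
Proof. exact: vabs_id. Qed.

Lemma vabsZ c x : 0 <= c -> vabs (c *: x) = c *: vabs x.
Proof.
have le (k : R) y : 0 <= k -> vabs (k *: y) <= k *: vabs y.
  by move=> k0; rewrite vabs_le -scalerN !vlerZ ?vle_abs ?vleN_abs.
rewrite le_eqVlt => /predU1P[<-|c0]; first by rewrite !scale0r vabs0.
apply: le_anti; rewrite (le _ _ (ltW c0))/=.
have ci0 : 0 <= c^-1 by rewrite invr_ge0 ltW.
have /(vlerZ (ltW c0)) := le _ (c *: x) ci0.
by rewrite !scalerA mulfV ?mulVf ?gt_eqF// !scale1r.
Qed.

Lemma vabsD x y : vabs (x + y) <= vabs x + vabs y.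
Proof. by rewrite vabs_le opprD !vlerD ?vle_abs ?vleN_abs. Qed.

Lemma vabsB x y : vabs (x - y) = vabs (y - x).
Proof. by rewrite -vabsN opprB. Qed.

Lemma vabs_distD y x z : vabs (x - z) <= vabs (x - y) + vabs (y - z).
Proof. by rewrite (le_trans _ (vabsD _ _))// addrA subrK. Qed.

Lemma vabs_dist_le x y z : vabs (x - y) <= z -> x <= y + z.
Proof. by rewrite vabs_le => /andP[+ _]; rewrite vlerBlDr addrC. Qed.

(** Why the positive part of a Lipschitz function is again Lipschitz: [x] is at
    most [y + |x - y|], which is at most [y^+ + |x - y|]. *)
Lemma vpos_dist x y : vabs (vsup x 0 - vsup y 0) <= vabs (x - y).
Proof.
have le (u v : X) : vsup u 0 - vsup v 0 <= vabs (u - v).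
  rewrite vlerBlDr vsup_le; apply/andP; split; last first.
    by rewrite vaddr_ge0 ?vabs_ge0 ?vsup_ger.
  by rewrite -{1}(subrK v u) vlerD ?vle_abs ?vsup_gel.
by rewrite vabs_le opprB le/= vabsB le.
Qed.

Lemma vposBneg x : vsup x 0 - vsup (- x) 0 = x.
Proof.
apply: le_anti; apply/andP; split.
  rewrite vlerBlDr vsup_le vlerDr ?vsup_ger//=.
  by rewrite addrC -vlerBlDr sub0r vsup_gel.
rewrite vlerBrDr addrC -vlerBrDr vsup_le vsubr_ge0 vsup_gel andbT.
by rewrite vlerBrDr addNr vsup_ger.
Qed.

Lemma vabs_sum (I : Type) (r : seq I) (P : pred I) (E : I -> X) :
  vabs (\sum_(i <- r | P i) E i) <= \sum_(i <- r | P i) vabs (E i).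
Proof.
elim/big_ind2 : _ => [|x y z t xy zt|i _]; last exact: lexx.
- by rewrite vabs0.
- by rewrite (le_trans (vabsD _ _))// vlerD.
Qed.

End vector_lattice.

(** * Order convergence *)
Section order_convergence.

(** As both sequences decrease, [y <= s p + t p] for all [p] gives
    [y <= s p + t q] for all [p] and [q], and the two infima can be taken one
    after the other. *)
Lemma o_sequenceD (T : porderZmodType)
    (TD : forall z x y : T, x <= y -> x + z <= y + z) (s t : nat -> T) :
  o_sequence s -> o_sequence t -> o_sequence (fun p => s p + t p).
Proof.
have leD (x y z w : T) : x <= y -> z <= w -> x + z <= y + w.
  move=> xy zw; apply: le_trans (TD z _ _ xy) _.
  by rewrite addrC (addrC y); exact: TD.
move=> [ds [s0 ls]] [dt [t0 lt]]; split.
  by move=> m n mn; apply: leD; [exact: ds|exact: dt].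
split=> [_ [p _ <-]|y ly].
  by rewrite -[X in (X <= _)%O]addr0 leD//; [apply: s0|apply: t0]; exists p.
have {}ly p q : y <= s p + t q.
  apply: le_trans (ly _ (ex_intro2 _ _ (maxn p q) I erefl)) _.
  by apply: leD; [apply: ds; exact: leq_maxl|apply: dt; exact: leq_maxr].
have h q : y - t q <= 0.
  apply: ls => _ [p _ <-]; rewrite -[X in (_ <= X)%O](addrK (t q)).
  exact/TD/ly.
apply: lt => _ [q _ <-]; rewrite -[y](subrK (t q)) -[X in (_ <= X)%O]add0r.
exact/TD/h.
Qed.

Lemma o_sequence_le0 (T : porderZmodType) (s : nat -> T) (y : T) :
  o_sequence s -> (forall p, y <= s p) -> y <= 0.
Proof. by move=> [_ [_ ls]] ys; apply: ls => _ [p _ <-]. Qed.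

Lemma o_sequenceZ (R : realType) (X : vectorLatticeType R) (c : R)
    (s : nat -> X) :
  0 < c -> o_sequence s -> o_sequence (fun p => c *: s p).
Proof.
move=> c0 [ds [s0 ls]]; split.
  by move=> m n mn; apply: vlerZ; [exact: ltW|exact: ds].
split=> [_ [p _ <-]|y ly].
  by apply: vlat_scaler_ge0; [exact: ltW|apply: s0; exists p].
have : c^-1 *: y <= 0.
  apply: ls => _ [p _ <-]; rewrite -[s p](scalerK (lt0r_neq0 c0)).
  apply: vlerZ; first by rewrite invr_ge0 ltW.
  by apply: ly; exists p.
move=> /(vlerZ (ltW c0)); rewrite scalerA mulfV ?gt_eqF// scale1r.
by rewrite scaler0.
Qed.

Lemma harmonic_o_sequence (R : realType) (c : R) :
  0 < c -> pos_o_sequence (fun p => c / p.+1%:R).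
Proof.
move=> c0; split=> [p|]; first by rewrite divr_gt0.
split=> [m n mn|]; first by rewrite ler_pM2l// lef_pV2 ?posrE// ler_nat.
split=> [_ [p _ <-]|y ly]; first by rewrite divr_ge0 ?ltW.
rewrite leNgt; apply/negP => y0.
have := ly _ (ex_intro2 _ _ (Num.truncn (c / y)) I erefl).
by rewrite ler_pdivlMr// mulrC -ler_pdivlMr// leNgt truncnS_gt.
Qed.

End order_convergence.

Section dedekind.
Context (R : realType) (X : dedekindVectorLatticeType R).

(** A supremum [S] of the multiples of [y], all of them below [u], would satisfy
    [S <= S - y]. *)
Lemma dedekind_archimedean (y u : X) :
  (forall n : nat, y <= n.+1%:R^-1 *: u) -> y <= 0.
Proof.
move=> yu; pose A := [set n.+1%:R *: y | n in [set: nat]].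
have [S [uS lS]] : supremums A !=set0.
  apply: dedekind_complete; first by exists (1%:R *: y), 0%N.
  exists u => _ [n _ <-]; have /(vlerZ (ler0n R n.+1)) := yu n.
  by rewrite scalerA mulfV ?pnatr_eq0// scale1r.
suff : S <= S - y by rewrite vlerBrDr addrC -vlerBrDr subrr.
apply: lS => _ [n _ <-]; rewrite vlerBrDr -{2}[y]scale1r -scalerDl natr1.
by apply: uS; exists n.+1.
Qed.

(** The Archimedean property turns numerical null sequences into order null
    sequences of multiples of [u]; every error term below has this form. *)
Lemma o_sequence_scale (s : nat -> R) (u : X) :
  0 <= u -> o_sequence s -> o_sequence (fun p => s p *: u).
Proof.
move=> u0 [ds [s0 ls]]; split=> [m n mn|].
  by apply: vlerZr => //; exact: ds.
split=> [_ [p _ <-]|y ly]; first by apply: vlat_scaler_ge0 => //; apply: s0; exists p.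
apply: (@dedekind_archimedean _ u) => n.
suff [p sp] : exists p, s p <= n.+1%:R^-1.
  by apply: le_trans (vlerZr u0 sp); apply: ly; exists p.
apply: contrapT => /forallNP h.
suff : n.+1%:R^-1 <= (0 : R) by rewrite leNgt invr_gt0 ltr0n.
by apply: ls => _ [p _ <-]; have /negP := h p; rewrite -ltNge => /ltW.
Qed.

(** Completeness: nested order intervals have a common point, namely the
    supremum of their left ends. *)
Lemma nested_limit (x c : nat -> X) :
  (forall m n, vabs (x m - x n) <= c m + c n) ->
  exists l, forall n, vabs (x n - l) <= c n.
Proof.
move=> xc; have le m n : x m - c m <= x n + c n.
  by rewrite vlerBlDr -addrA (addrC (c n)) vabs_dist_le.
have [S [uS lS]] : supremums [set x n - c n | n in [set: nat]] !=set0.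
  apply: dedekind_complete; first by exists (x 0%N - c 0%N), 0%N.
  by exists (x 0%N + c 0%N) => _ [n _ <-].
exists S => n; rewrite vabs_le opprB !vlerBlDr; apply/andP; split.
  by rewrite addrC -vlerBlDr; apply: uS; exists n.
by rewrite addrC; apply: lS => _ [m _ <-].
Qed.

End dedekind.

Section order_unit.
Context (R : realType) (X : orderUnitFAlgType R).
Local Notation e := (vunit : X).

(** Some positive multiple of the unit dominates [|0|]. *)
Lemma vunit_ge0 : 0 <= e.
Proof.
have [c c0 h] := order_unitP (0 : X).
have : 0 <= c^-1 *: (c *: e).
  apply: vlat_scaler_ge0; first by rewrite invr_ge0 ltW.
  by rewrite (le_trans (vabs_ge0 _) h).
by rewrite scalerA mulVf ?gt_eqF// scale1r.
Qed.

Lemma vunit_scale_gt0 (c : R) : 0 < c -> 0 < c *: e.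
Proof.
move=> c0; rewrite lt_def scaler_eq0 negb_or gt_eqF//= vunit_neq0/=.
exact: vlat_scaler_ge0 (ltW c0) vunit_ge0.
Qed.

Lemma vmulr1 (x : X) : vmul x e = x.
Proof. by rewrite vmulC vmul1l. Qed.

Lemma vle_lim (x y : X) (M : R) : 0 < M ->
  (forall n, x <= y + (M / n.+1%:R) *: e) -> x <= y.
Proof.
move=> M0 xy; rewrite -[y]addr0 addrC -vlerBlDr.
have [_ oM] := harmonic_o_sequence M0.
apply: (o_sequence_le0 (o_sequence_scale vunit_ge0 oM)) => n.
by rewrite vlerBlDr addrC.
Qed.

End order_unit.

(** * The integral of simple functions *)
Section simple_functions.
Context (R : realType) (X : orderUnitFAlgType R).
Context (d : measure_display) (T : measurableType d).
Context (mu : {measure set T -> \bar R}) (G : set T).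
Hypotheses (mG : measurable G) (muG : (mu G < +oo)%E).

(** Simplicity of functions with values in an arbitrary type, so that it applies
    to pairs of simple functions, to indicators and to the index of the piece
    of a subdivision. *)
Definition finitely_valued (J : choiceType) (h : T -> J) : Prop :=
  finite_set (h @` G) /\ forall j, measurable (G `&` h @^-1` [set j]).

Definition fibre_measure (J : choiceType) (h : T -> J) (j : J) : R :=
  fine (mu (G `&` h @^-1` [set j])).

Lemma simpleP (f : T -> X) : simple G f <-> finitely_valued f.
Proof.
split=> [[fG mf]|[fG mf]]; split=> // x; first by have [] := mf x.
Qed.

Lemma finitely_valued_comp (J K : choiceType) (h : T -> J) (phi : J -> K)
    (g : T -> K) :
  (forall t, G t -> g t = phi (h t)) -> finitely_valued h -> finitely_valued g.
Proof.
move=> gE [fh mh]; split.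
  apply: (@sub_finite_set _ _ (phi @` (h @` G))); last exact: finite_image.
  by move=> _ [t Gt <-]; exists (h t); [exists t|rewrite gE].
move=> k.
have -> : G `&` g @^-1` [set k] =
    \bigcup_(j in h @` G `&` phi @^-1` [set k]) (G `&` h @^-1` [set j]).
  apply/seteqP; split=> [t [Gt /= gk]|t [j [_ /= jk] [Gt /= hj]]].
    by exists (h t) => //; split; [exists t|rewrite /= -gE].
  by split=> //=; rewrite gE// hj.
apply: fin_bigcup_measurable => [|j _]; last exact: mh.
exact/finite_setIl/fh.
Qed.

Lemma finitely_valued_pair (J K : choiceType) (h : T -> J) (k : T -> K) :
  finitely_valued h -> finitely_valued k ->
  finitely_valued (fun t => (h t, k t)).
Proof.
move=> [fh mh] [fk mk]; split.
  apply: (@sub_finite_set _ _ ((h @` G) `*` (k @` G))); last exact: finite_setX.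
  by move=> _ [t Gt <-]; split; exists t.
move=> [i j].
have -> : G `&` (fun t => (h t, k t)) @^-1` [set (i, j)] =
    (G `&` h @^-1` [set i]) `&` (G `&` k @^-1` [set j]).
  apply/seteqP; split=> [t [Gt /= [<- <-]]//|t [[Gt /= <-] [_ /= <-]]//].
exact: measurableI.
Qed.

Lemma finitely_valued_indic (A : set T) :
  measurable A -> finitely_valued (fun t => t \in A).
Proof.
move=> mA; split; first exact: finite_finset.
case; first have -> : (fun t => t \in A) @^-1` [set true] = A.
- by apply/seteqP; split=> t /=; [move/set_mem|move/mem_set].
- exact: measurableI.
have -> : (fun t => t \in A) @^-1` [set false] = ~` A.
  apply/seteqP; split=> t /=; first by move=> /negbT/negP nA At; apply/nA/mem_set.
  by move=> nA; apply/negbTE/negP => /set_mem.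
exact/measurableI/measurableC.
Qed.

Lemma measure_fin (A : set T) : measurable A -> A `<=` G -> mu A \is a fin_num.
Proof.
by move=> mA AG; rewrite ge0_fin_numE// (le_lt_trans _ muG)// le_measure ?inE.
Qed.

Lemma fibre_measure_ge0 (J : choiceType) (h : T -> J) j : 0 <= fibre_measure h j.
Proof. by rewrite fine_ge0. Qed.

(** Finite additivity of [mu]: a fibre of [phi \o h] is the disjoint union of the
    fibres of [h] over the points that [phi] sends to its value. *)
Lemma fibre_measure_comp (J K : choiceType) (h : T -> J) (phi : J -> K)
    (g : T -> K) (r : seq J) (k : K) :
  finitely_valued h -> (forall t, G t -> g t = phi (h t)) ->
  uniq r -> (forall t, G t -> h t \in r) ->
  fibre_measure g k = \sum_(j <- r | phi j == k) fibre_measure h j.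
Proof.
move=> [fh mh] gE ur hr.
rewrite /fibre_measure sum_fine; last by move=> j _; apply: measure_fin => // t [].
congr fine; rewrite -big_filter fsbig_seq ?filter_uniq// -measure_fin_bigcup//=.
- congr (mu _); apply/seteqP; split=> [t [Gt /= gk]|t [j /=]].
    by exists (h t) => //=; rewrite mem_filter -gE// gk eqxx hr.
  rewrite mem_filter => /andP[/eqP <- _] [Gt /= hj]; split=> //=.
  by rewrite gE// hj.
- by move=> i j _ _ [t [[_ /= <-] [_ /= <-]]].
Qed.

(** Change of variables: a function that factors through a finitely valued [h]
    is integrated by summing over the fibres of [h].  Any two simple functions
    factor through their pair, so all comparisons of integrals reduce to
    comparisons of finite sums. *)
Lemma simple_integral_comp (J : choiceType) (h : T -> J) (phi : J -> X)
    (f : T -> X) (r : seq J) :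
  finitely_valued h -> (forall t, G t -> f t = phi (h t)) ->
  uniq r -> (forall t, G t -> h t \in r) ->
  simple_integral mu G f = \sum_(j <- r) fibre_measure h j *: phi j.
Proof.
move=> hh fE ur hr; rewrite /simple_integral.
rewrite (fsbig_fwiden (undup (map phi r))) ?undup_uniq//; first last.
- move=> c [_ /= nfc]; rewrite (_ : _ `&` _ = set0) ?measure0 ?scale0r//.
  by apply/seteqP; split=> // t [Gt /= fc]; apply: nfc; exists t.
- by move=> _ [t Gt <-] /=; rewrite mem_undup fE// map_f// hr.
(* Both sides become a double sum over the values [c] of [f] and the indices
   [j], restricted to [phi j = c]; each [j] meets exactly one [c]. *)
transitivity (\sum_(c <- undup (map phi r))
    \sum_(j <- r) if phi j == c then fibre_measure h j *: phi j else 0).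
  apply: eq_bigr => c _; rewrite -[fine _]/(fibre_measure f c).
  rewrite (fibre_measure_comp _ hh fE ur hr) scaler_suml -big_mkcond.
  by apply: eq_bigr => j /eqP ->.
rewrite exchange_big/=; apply: eq_big_seq => j jr.
rewrite (bigD1_seq (phi j)) ?undup_uniq ?mem_undup ?map_f//= eqxx.
by rewrite big1 ?addr0// => c; rewrite eq_sym => /negbTE ->.
Qed.

Definition values (J : choiceType) (h : T -> J) : seq J :=
  finmap.enum_fset (fset_set (h @` G)).

Lemma values_uniq (J : choiceType) (h : T -> J) : uniq (values h).
Proof. exact: finmap.fset_uniq. Qed.

Lemma mem_values (J : choiceType) (h : T -> J) :
  finitely_valued h -> forall t, G t -> h t \in values h.
Proof. by move=> [fh _] t Gt; rewrite in_fset_set// inE; exists t. Qed.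

Lemma valuesP (J : choiceType) (h : T -> J) j :
  finitely_valued h -> j \in values h -> exists2 t, G t & h t = j.
Proof. by move=> [fh _]; rewrite in_fset_set// inE. Qed.

Lemma simple_comp2 (f g : T -> X) (op : X -> X -> X) :
  simple G f -> simple G g -> simple G (fun t => op (f t) (g t)).
Proof.
move=> /simpleP hf /simpleP hg; apply/simpleP.
by apply: (finitely_valued_comp (phi := fun x => op x.1 x.2))
  (finitely_valued_pair hf hg).
Qed.

Lemma simple_comp (f : T -> X) (op : X -> X) :
  simple G f -> simple G (fun t => op (f t)).
Proof. by move=> hf; exact: (simple_comp2 (fun x _ => op x) hf hf). Qed.

Lemma simple_restr (f : T -> X) (A : set T) :
  measurable A -> simple G f -> simple G (restr f A).
Proof.
move=> mA /simpleP hf; apply/simpleP.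
apply: (finitely_valued_comp (phi := fun x : X * bool => x.2%:R *: x.1))
  (finitely_valued_pair hf (finitely_valued_indic mA)) => t _.
by rewrite /restr indicE.
Qed.

Lemma simple_cst (c : X) : simple G (fun=> c).
Proof.
apply/simpleP; apply: (finitely_valued_comp (phi := fun=> c)) => //.
exact: (finitely_valued_indic measurableT).
Qed.

Lemma simple_integral_ext (f g : T -> X) :
  (forall t, G t -> f t = g t) -> simple_integral mu G f = simple_integral mu G g.
Proof.
move=> fg; rewrite /simple_integral.
rewrite (_ : f @` G = g @` G); last first.
  by apply/seteqP; split=> _ [t Gt <-]; exists t; rewrite ?fg.
apply: eq_fsbigr => c _; congr (fine (mu _) *: _).
by apply/seteqP; split=> t [Gt /= <-]; split; rewrite //= fg.
Qed.

Lemma simple_integral_lin (a b : R) (f g : T -> X) :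
  simple G f -> simple G g ->
  simple_integral mu G (fun t => a *: f t + b *: g t) =
  a *: simple_integral mu G f + b *: simple_integral mu G g.
Proof.
move=> /simpleP hf /simpleP hg; pose h t := (f t, g t).
have hh : finitely_valued h := finitely_valued_pair hf hg.
have E phi := @simple_integral_comp _ h phi _ _ hh (fun _ _ => erefl)
  (values_uniq h) (mem_values hh).
rewrite (E (fun x => a *: x.1 + b *: x.2)) (E fst) (E snd) !scaler_sumr -big_split/=.
by apply: eq_bigr => j _; rewrite scalerDr !scalerA ![_ * fibre_measure _ _]mulrC.
Qed.

Lemma simple_integralD (f g : T -> X) :
  simple G f -> simple G g ->
  simple_integral mu G (fun t => f t + g t) =
  simple_integral mu G f + simple_integral mu G g.
Proof.
move=> hf hg; have := simple_integral_lin 1 1 hf hg; rewrite !scale1r => <-.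
by apply: simple_integral_ext => t _; rewrite !scale1r.
Qed.

Lemma simple_integralZ (a : R) (f : T -> X) :
  simple G f ->
  simple_integral mu G (fun t => a *: f t) = a *: simple_integral mu G f.
Proof.
move=> hf; have := simple_integral_lin a 0 hf hf; rewrite scale0r addr0 => <-.
by apply: simple_integral_ext => t _; rewrite scale0r addr0.
Qed.

Lemma simple_integralB (f g : T -> X) :
  simple G f -> simple G g ->
  simple_integral mu G (fun t => f t - g t) =
  simple_integral mu G f - simple_integral mu G g.
Proof.
move=> hf hg; have := simple_integral_lin 1 (-1) hf hg.
rewrite scale1r scaleN1r => <-.
by apply: simple_integral_ext => t _; rewrite scale1r scaleN1r.
Qed.

Lemma le_simple_integral (f g : T -> X) :
  simple G f -> simple G g -> (forall t, G t -> f t <= g t) ->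
  simple_integral mu G f <= simple_integral mu G g.
Proof.
move=> /simpleP hf /simpleP hg fg; pose h t := (f t, g t).
have hh : finitely_valued h := finitely_valued_pair hf hg.
have E phi := @simple_integral_comp _ h phi _ _ hh (fun _ _ => erefl)
  (values_uniq h) (mem_values hh).
rewrite (E fst) (E snd) !big_seq; apply: vler_sum => _ /(valuesP hh)[t Gt <-].
by apply: vlerZ; [exact: fibre_measure_ge0|exact: fg].
Qed.

Lemma simple_integral_abs (f : T -> X) :
  simple G f -> vabs (simple_integral mu G f) <= iota_int mu G f.
Proof.
move=> hf; have hv : simple G (fun t => vabs (f t)) := simple_comp (@vabs _ _) hf.
rewrite vabs_le le_simple_integral//=; last by move=> t _; exact: vle_abs.
rewrite -scaleN1r -simple_integralZ// le_simple_integral//.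
  exact: (simple_comp (fun x => -1 *: x)).
by move=> t _; rewrite scaleN1r vleN_abs.
Qed.

Lemma simple_integral_restr_cst (c : X) (A : set T) :
  msub G A -> simple_integral mu G (restr (fun=> c) A) = fine (mu A) *: c.
Proof.
move=> [mA AG].
rewrite (@simple_integral_comp _ _ (fun b : bool => b%:R *: c) _ [:: true; false]
  (finitely_valued_indic mA)) => [|t _||t _]; rewrite /restr ?indicE//; last first.
  by case: (_ \in _).
rewrite big_cons big_seq1 scale1r scale0r scaler0 addr0; congr (fine (mu _) *: _).
apply/seteqP; split=> t /=; first by move=> [_ /set_mem].
by move=> At; split; [exact: AG|exact: mem_set].
Qed.

Lemma restrT (f : T -> X) t : G t -> restr f G t = f t.
Proof. by move=> Gt; rewrite /restr indicE mem_set// scale1r. Qed.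

Lemma simple_integral_restrG (f : T -> X) :
  simple_integral mu G (restr f G) = simple_integral mu G f.
Proof. by apply: simple_integral_ext => t Gt; rewrite restrT. Qed.

Lemma simple_integral_cst (c : X) :
  simple_integral mu G (fun=> c) = fine (mu G) *: c.
Proof. rewrite -(simple_integral_restrG (fun=> c)) simple_integral_restr_cst//.
by split. Qed.

(** The integrals over [A] of uniformly close simple functions are close,
    uniformly in [A]; this is what makes the integrals of a uniformly convergent
    sequence a Cauchy sequence. *)
Lemma simple_integral_dist (f g : T -> X) (A : set T) (c : X) :
  simple G f -> simple G g -> msub G A ->
  (forall t, G t -> vabs (f t - g t) <= c) ->
  vabs (simple_integral mu G (restr f A) - simple_integral mu G (restr g A))
    <= fine (mu A) *: c.
Proof.
move=> hf hg mA fgc; have [mA' _] := mA.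
rewrite -simple_integralB; [|exact: simple_restr|exact: simple_restr].
rewrite -simple_integral_restr_cst//.
have hd : simple G (fun t => restr f A t - restr g A t).
  by apply: (simple_comp2 (fun x y => x - y)); exact: simple_restr.
rewrite (le_trans (simple_integral_abs hd))//; apply: le_simple_integral => [||t Gt].
- exact: (simple_comp (@vabs _ _)).
- exact/simple_restr/simple_cst.
rewrite /restr -scalerBr vabsZ ?vlerZ ?indicE ?ler0n//.
exact: fgc.
Qed.

Lemma le_iota_int (f : T -> X) (A : set T) (c : X) :
  simple G f -> msub G A -> (forall t, G t -> vabs (f t) <= c) ->
  iota_int mu G (restr f A) <= fine (mu A) *: c.
Proof.
move=> hf mA fc; have [mA' _] := mA.
rewrite -simple_integral_restr_cst//; apply: le_simple_integral => [||t Gt].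
- exact/(simple_comp (@vabs _ _))/simple_restr.
- exact/simple_restr/simple_cst.
by rewrite /restr vabsZ ?vlerZ ?indicE ?ler0n//; exact: fc.
Qed.

End simple_functions.

(** * Uniqueness of the integral *)
Section integral.
Context (R : realType) (X : orderUnitFAlgType R).
Context (d : measure_display) (T : measurableType d).
Context (mu : {measure set T -> \bar R}) (G : set T).
Hypotheses (mG : measurable G) (muG : (mu G < +oo)%E).
Local Notation e := (vunit : X).
Local Notation SI := (simple_integral mu G).

Lemma msubG : msub G G. Proof. by split. Qed.

Lemma msub_finG : msub_fin mu G G. Proof. by split=> //; exact: msubG. Qed.

(** Off [A `|` A'] both functions are uniformly close to [h], hence to each other;
    on it, their distance is at most the sum of their absolute values. *)
Lemma simple_integral_dist_off (f g h : T -> X) (eps eps' al al' : R)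
    (A A' : set T) :
  simple G f -> simple G g -> msub G A -> msub G A' -> 0 < al -> 0 < al' ->
  [set t | G t /\ ~ vabs (f t - h t) <= eps *: e] `<=` A ->
  [set t | G t /\ ~ vabs (g t - h t) <= eps' *: e] `<=` A' ->
  0 <= eps -> 0 <= eps' ->
  vabs (SI f - SI g) <= fine (mu G) *: ((eps + eps') *: e) +
    (al^-1 *: iota_int mu G (restr (fun t => al *: f t) (A `|` A')) +
     al'^-1 *: iota_int mu G (restr (fun t => al' *: g t) (A `|` A'))).
Proof.
move=> hf hg [mA AG] [mA' AG'] al0 al'0 fA gA' eps0 eps'0.
set B := A `|` A'; have mB : measurable B by exact: measurableU.
pose c : X := (eps + eps') *: e.
pose abs_on (k : R) (u : T -> X) t := vabs (restr (fun t => k *: u t) B t).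
have habs k u : simple G u -> simple G (abs_on k u).
  move=> hu; apply/(simple_comp (@vabs _ _))/simple_restr => //.
  exact: (simple_comp (fun x => k *: x)).
have habsE (k : R) u t : 0 < k -> B t -> k^-1 *: abs_on k u t = vabs (u t).
  move=> k0 Bt; rewrite /abs_on /restr indicE mem_set// scale1r vabsZ ?ltW//.
  by rewrite scalerA mulVf ?gt_eqF// scale1r.
have hfg : simple G (fun t => f t - g t) := simple_comp2 (fun x y => x - y) hf hg.
rewrite -simple_integralB// (le_trans (simple_integral_abs mG muG hfg))//.
have h1 := simple_cst mG c.
have h2 : simple G (fun t => al^-1 *: abs_on al f t + al'^-1 *: abs_on al' g t).
  by apply: (simple_comp2 (fun x y => al^-1 *: x + al'^-1 *: y)); exact: habs.
rewrite /iota_int -simple_integral_lin; [|by []|by []|exact: habs|exact: habs].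
rewrite -simple_integral_cst// -simple_integralD//.
apply: le_simple_integral => // [||t Gt].
- exact: (simple_comp (@vabs _ _)).
- exact: (simple_comp2 (fun x y => x + y)).
have c0 : 0 <= c by apply: vlat_scaler_ge0; [exact: addr_ge0|exact: vunit_ge0].
have abs0 (k : R) u : 0 < k -> 0 <= k^-1 *: abs_on k u t.
  by move=> k0; apply: vlat_scaler_ge0; [rewrite invr_ge0 ltW|exact: vabs_ge0].
have [Bt|nBt] := pselect (B t).
  rewrite !habsE// -[X in X <= _]add0r vlerD//.
  by rewrite -(vabsN (g t)) vabsD.
rewrite -[X in X <= _]addr0; apply: vlerD; last by rewrite vaddr_ge0 ?abs0.
have ft : vabs (f t - h t) <= eps *: e.
  apply: contrapT => /negP/negP nf; apply: nBt; left; apply: fA.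
  by split => //; exact/negP.
have gt : vabs (g t - h t) <= eps' *: e.
  apply: contrapT => /negP/negP nf; apply: nBt; right; apply: gA'.
  by split => //; exact/negP.
rewrite (le_trans (vabs_distD (h t) _ _))// /c scalerDl vlerD//.
by rewrite vabsB.
Qed.

Variable F : set_system nat.
Hypothesis hF : free_filter F.

(** Two approximating sequences are compared at an index [n] at which both are
    uniformly close to [f] off a set of small measure, equi-absolute continuity
    applies to this set, and both integrals are near their limits. Such an [n]
    exists since each condition holds on a member of the filter. *)
Lemma pos_integral_unique (f : T -> X) (l l' : set T -> X) :
  pos_integral F mu G f l -> pos_integral F mu G f l' -> l G = l' G.
Proof.
suff le k k' : pos_integral F mu G f k -> pos_integral F mu G f k' ->
    k G - k' G <= 0.
  move=> hl hl'; apply: le_anti; apply/andP; split.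
    by have := le _ _ hl hl'; rewrite vlerBlDr add0r.
  by have := le _ _ hl' hl; rewrite vlerBlDr add0r.
have PF : ProperFilter F := hF.1.
move=> [_ [u [hu [al [al0 eu _]] [eps [sig [A [oeps osig mA uA FA]]]]
  [S supS [s os Fs]]]]].
move=> [_ [v [hv [al' [al'0 ev _]] [eps' [sig' [A' [oeps' osig' mA' vA' FA']]]]
  [S' supS' [s' os' Fs']]]]].
have [eps0 {}oeps] := oeps; have [eps'0 {}oeps'] := oeps'.
have [sig0 {}osig] := osig; have [sig'0 {}osig'] := osig'.
have RD (z x y : R) : x <= y -> x + z <= y + z by move=> ?; rewrite lerD2r.
have osum : pos_o_sequence (fun p => sig p + sig' p).
  by split=> [p|]; [exact: addr_gt0|exact: o_sequenceD].
have [w [La [[_ ow] FLa Lw]]] := eu _ osum.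
have [w' [La' [[_ ow'] FLa' Lw']]] := ev _ osum.
have XD : forall z x y : X, x <= y -> x + z <= y + z := @vlat_lerD2r _ X.
have muG0 : 0 <= fine (mu G) by rewrite fine_ge0.
(* The distance of the two integrals is below [b p] for every [p]: the terms
   come from the good set, the bad set and the two limits. The added 1 keeps the
   first coefficient positive when [G] is null. *)
pose b p : X := (fine (mu G) + 1) *: ((eps p + eps' p) *: e) +
  (al^-1 *: w p + al'^-1 *: w' p) + (s p + s' p).
apply: (@o_sequence_le0 _ b).
  apply: o_sequenceD => //; last exact: o_sequenceD.
  apply: o_sequenceD => //.
    apply: o_sequenceZ; first by rewrite ltr_wpDl.
    by apply: o_sequence_scale; [exact: vunit_ge0|exact: o_sequenceD].
  by apply: o_sequenceD => //; apply: o_sequenceZ; rewrite ?invr_gt0.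
move=> p.
have [n [[[Ln L'n] [An A'n]] [sn s'n]]] := filter_ex (filterI
  (filterI (filterI (FLa p) (FLa' p)) (filterI (FA p) (FA' p)))
  (filterI (Fs p) (Fs' p))).
have near_l (x : nat -> T -> X) (m : set T -> X) (U : nat -> X) (c : X) :
    (forall n, supremums
      [set vabs (SI (restr (x n) B) - m B) | B in msub G] (U n)) ->
    vabs (U n - 0) <= c -> vabs (SI (x n) - m G) <= c.
  move=> supU; rewrite subr0 => Uc; rewrite (le_trans _ Uc)//.
  rewrite (le_trans _ (vle_abs _))//; have [ubU _] := supU n; apply: ubU.
  by exists G; [exact: msubG|rewrite simple_integral_restrG].
have {}sn := near_l _ _ _ _ supS sn.
have {}s'n := near_l _ _ _ _ supS' s'n.
have muB : (mu (A n p `|` A' n p) <= (sig p + sig' p)%:E)%E.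
  have [[mAn _] [mA'n _]] := (mA n p, mA' n p).
  by rewrite EFinD (le_trans (measureU2 _ _ _))// leeD.
have mB : msub G (A n p `|` A' n p).
  have [[mAn AG] [mA'n A'G]] := (mA n p, mA' n p).
  by split; [exact: measurableU|move=> t [/AG|/A'G]].
have uv := simple_integral_dist_off (proj1 (hu n)) (proj1 (hv n)) (mA n p)
  (mA' n p) al0 al'0 (uA n p) (vA' n p) (ltW (eps0 p)) (ltW (eps'0 p)).
have {}uv : vabs (SI (u n) - SI (v n)) <= (fine (mu G) + 1) *:
    ((eps p + eps' p) *: e) + (al^-1 *: w p + al'^-1 *: w' p).
  rewrite (le_trans uv)// vlerD//.
    rewrite vlerZr ?lerDl//; apply: vlat_scaler_ge0; last exact: vunit_ge0.
    by rewrite addr_ge0 ?ltW.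
  apply: vlerD; (apply: vlerZ; first by rewrite invr_ge0 ltW).
    exact: Lw.
  exact: Lw'.
rewrite (le_trans (vle_abs _))// (le_trans (vabs_distD (SI (u n)) _ _))//.
rewrite vabsB /b addrCA vlerD//.
by rewrite (le_trans (vabs_distD (SI (v n)) _ _))// vlerD.
Qed.

End integral.

(** * Uniform limits of simple functions *)
Lemma free_filter_ge (F : set_system nat) (P : set nat) (N : nat) :
  free_filter F -> (forall n, (N <= n)%N -> P n) -> F P.
Proof.
move=> [_ hF] NP; apply: hF; apply: (@sub_finite_set _ _ `I_N); last exact: finite_II.
by move=> n /= nP; rewrite ltnNge; apply/negP => /NP.
Qed.

Section uniform_limit.
Context (R : realType) (X : orderUnitFAlgType R).
Context (d : measure_display) (T : measurableType d).
Context (mu : {measure set T -> \bar R}) (G : set T).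
Hypotheses (mG : measurable G) (muG : (mu G < +oo)%E).
Variable F : set_system nat.
Hypothesis hF : free_filter F.
Local Notation e := (vunit : X).
Local Notation SI := (simple_integral mu G).

(** A uniform limit of uniformly bounded simple functions is integrable. The
    exceptional sets can be taken empty from some rank on, the common bound
    [K *: e] gives equi-absolute continuity, and the integrals over [A] are
    Cauchy uniformly in [A], so that completeness supplies the set function. *)
Lemma pos_integral_uniform_limit (f : T -> X) (fn : nat -> T -> X) (C K : R) :
  0 < C -> 0 < K -> (forall t, G t -> 0 <= f t) ->
  (forall n, simple G (fn n)) ->
  (forall n t, G t -> vabs (fn n t - f t) <= (C / n.+1%:R) *: e) ->
  (forall n t, G t -> vabs (fn n t) <= K *: e) ->
  exists2 l, pos_integral F mu G f l &
    forall n, vabs (SI (fn n) - l G) <= ((fine (mu G) + 1) * C / n.+1%:R) *: e.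
Proof.
move=> C0 K0 f0 sfn fnf fnK; set m := fine (mu G).
have m0 : 0 <= m by rewrite fine_ge0.
have PF : ProperFilter F := hF.1.
have e0 : 0 <= e := vunit_ge0 X.
(* The added 1 keeps [M] positive when [G] is null. *)
pose M := (m + 1) * C; have M0 : 0 < M by rewrite mulr_gt0// ltr_wpDl.
pose c n : X := (M / n.+1%:R) *: e.
have [Mpos oM] := harmonic_o_sequence M0.
have oc : o_sequence c := o_sequence_scale e0 oM.
have fine_le A : msub G A -> fine (mu A) <= m.
  move=> [mA AG]; rewrite fine_le ?(measure_fin mG muG)//.
  by rewrite le_measure ?inE.
have /choice[l lP] : forall A, exists y, msub G A -> forall n,
    vabs (SI (restr (fn n) A) - y) <= c n.
  move=> A; have [mA|nmA] := pselect (msub G A); last by exists 0.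
  have [y yP] : exists y, forall n, vabs (SI (restr (fn n) A) - y) <= c n.
    apply: nested_limit => i j.
    have ij t : G t -> vabs (fn i t - fn j t) <= (C / i.+1%:R + C / j.+1%:R) *: e.
      move=> Gt; rewrite (le_trans (vabs_distD (f t) _ _))// scalerDl vlerD ?fnf//.
      by rewrite vabsB fnf.
    rewrite (le_trans (simple_integral_dist mG muG (sfn i) (sfn j) mA ij))//.
    rewrite /c -scalerDl scalerA vlerZr// /M -!mulrA -!mulrDr.
    rewrite ler_wpM2r ?mulr_ge0 ?addr_ge0 ?invr_ge0 ?(ltW C0)//.
    by rewrite (le_trans (fine_le _ mA))// lerDl.
  by exists y.
have /choice[S SP] : forall n, exists s, supremums
    [set vabs (SI (restr (fn n) A) - l A) | A in msub G] s.
  move=> n; apply: dedekind_complete.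
    by exists (vabs (SI (restr (fn n) G) - l G)), G => //; exact: msubG.
  by exists (c n) => _ [A mA <-]; exact: lP.
exists l; last first.
  by move=> n; rewrite -simple_integral_restrG; apply: lP; exact: msubG.
split=> //; exists fn; split.
- by move=> n; split=> //; exists G; [exact: msub_finG|].
- exists 1; split=> //.
  + move=> sig [sig0 osig]; exists (fun p => (K * sig p) *: e), (fun=> setT).
    split=> [|p|p n B _ mB muB]; last 1 first.
    * have sf : simple G (fun t => 1 *: fn n t) := simple_comp (fun x => 1 *: x) (sfn n).
      rewrite (le_trans (le_iota_int mG muG (c := K *: e) sf mB _))//.
        by move=> t Gt; rewrite scale1r fnK.
      rewrite scalerA mulrC vlerZr// ler_pM2l//.
      have [mB' BG] := mB.
      by rewrite -lee_fin fineK// (measure_fin mG muG).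
    * split=> [p|]; first by rewrite vunit_scale_gt0 ?mulr_gt0.
      have -> : (fun p => (K * sig p) *: e) = (fun p => K *: (sig p *: e)).
        by apply/funext => p; rewrite scalerA.
      exact/o_sequenceZ/o_sequence_scale.
    * exact: filterT.
  + have [r0 or] := harmonic_o_sequence (@ltr01 R).
    exists (fun p => (1 / p.+1%:R) *: e), (fun=> G); split=> [|_|p].
    * by split=> [p|]; [exact/vunit_scale_gt0|exact: o_sequence_scale].
    * exact: msub_finG.
    * apply: (free_filter_ge (N := 0)) => // n _ /=.
      rewrite setDv; set g := fun t => _.
      have sg : simple G g := simple_comp (fun x => 1 *: x) (sfn n).
      have m00 : msub G set0 by split; [exact: measurable0|exact: sub0set].
      rewrite (le_trans (le_iota_int mG muG (c := K *: e) sg m00 _))//.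
        by move=> t Gt; rewrite /g scale1r fnK.
      by rewrite measure0 scale0r ltW// vunit_scale_gt0.
- pose eps p : R := 1 / p.+1%:R.
  have oeps : pos_o_sequence eps := harmonic_o_sequence (@ltr01 R).
  pose A n p := if C / n.+1%:R <= eps p then set0 else G.
  exists eps, eps, A; split=> //.
  + by move=> n p; rewrite /A; case: ifP => _; [split=> //|exact: msubG].
  + move=> n p t [Gt nfp]; rewrite /A; case: ifP => // Ce; exfalso; apply: nfp.
    by rewrite (le_trans (fnf n t Gt))// vlerZr.
  + move=> p; apply: (free_filter_ge (N := Num.truncn (C * p.+1%:R))) => // n Nn /=.
    rewrite /A ifT ?measure0 ?lee_fin ?divr_ge0//.
    rewrite ler_pdivlMr// mulrAC ler_pdivrMr// mul1r.
    by rewrite (le_trans (ltW (truncnS_gt _)))// ler_nat.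
- exists S => //; exists c => // p.
  apply: (free_filter_ge (N := p)) => // n pn /=; rewrite subr0.
  have [ubS lbS] := SP n.
  rewrite vabs_id; last first.
    rewrite (le_trans (vabs_ge0 (SI (restr (fn n) G) - l G)))//.
    by apply: ubS; exists G; [exact: msubG|].
  rewrite (le_trans (_ : _ <= c n))//; last by case: oc => dc _; exact: dc.
  by apply: lbS => _ [A mA <-]; exact: lP.
Qed.

End uniform_limit.

(** * Subdivisions of a segment *)
Section lebesgue_interval.
Context (R : realType).
Local Notation mu := (@completed_lebesgue_measure R).

Lemma caratheodory_measurable_itv (i : interval R) :
  (@wlength R idfun)^*%mu.-cara.-measurable [set` i].
Proof. by apply: sub_caratheodory; exact: measurable_itv. Qed.

Lemma completed_lebesgue_measure_itv (i : interval R) :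
  mu [set` i] = (if (i.1 < i.2)%E then (i.2 - i.1)%E else 0%E).
Proof. exact: lebesgue_measure_itv. Qed.

Lemma completed_lebesgue_measure_bnd (x y : R) (b1 b2 : bool) :
  x <= y -> mu [set` Interval (BSide b1 x) (BSide b2 y)] = (y - x)%:E.
Proof.
move=> xy; rewrite completed_lebesgue_measure_itv/= lte_fin.
by case: ltgtP xy => // -> _; rewrite subrr.
Qed.

End lebesgue_interval.

Section midpoint_pieces.
Context (R : realType) (X : orderUnitFAlgType R).
Context (a b : R) (ab : a < b).
Local Notation mu := (@completed_lebesgue_measure R).
Local Notation L := (caratheodory_type (@wlength R idfun)^*%mu).
Local Notation G := (`[a, b]%classic : set L).
Local Notation e := (vunit : X).
Implicit Types (f : R -> X) (n i : nat).

Definition mesh n : R := (b - a) / n.+1%:R.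

(** The index of the piece of [t] in the subdivision of [[a, b]] into [n.+1]
    half-open pieces of length [mesh n]. The point [b] alone has index [n.+1]. *)
Definition piece n (t : R) : nat := Num.truncn ((t - a) / mesh n).

(** Midpoints as sample points make the Riemann sums symmetric about the centre
    of the segment. The value [b] is the sample point of the null piece. *)
Definition node n i : R :=
  if (i <= n)%N then a + (i%:R + 2^-1) * mesh n else b.

Definition step n f : R -> X := fun t => f (node n (piece n t)).

(** The midpoint rule, that is the integral of [step n f]. *)
Definition midpoint_sum n f : X :=
  mesh n *: \sum_(0 <= i < n.+1) f (a + (i%:R + 2^-1) * mesh n).

Lemma mesh_gt0 n : 0 < mesh n.
Proof. by rewrite divr_gt0 ?subr_gt0. Qed.

Lemma meshMn n : n.+1%:R * mesh n = b - a.
Proof. by rewrite mulrC divfK ?pnatr_eq0. Qed.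

Lemma pieceP n t i : a <= t ->
  (piece n t == i) = (a + i%:R * mesh n <= t < a + i.+1%:R * mesh n).
Proof.
move=> at_; have s0 := mesh_gt0 n.
have -> : (a + i%:R * mesh n <= t < a + i.+1%:R * mesh n) =
    (i%:R <= (t - a) / mesh n < i.+1%:R).
  by rewrite ler_pdivlMr// ltr_pdivrMr// lerBrDl ltrBlDl.
apply/eqP/idP => [<-|]; last exact: truncn_def.
by rewrite truncn_itv// divr_ge0 ?subr_ge0// ltW.
Qed.

Lemma piece_itv n t : a <= t ->
  a + (piece n t)%:R * mesh n <= t < a + (piece n t).+1%:R * mesh n.
Proof. by move=> at_; rewrite -pieceP. Qed.

Lemma piece_le n t : G t -> (piece n t <= n.+1)%N.
Proof.
rewrite /= in_itv/= => /andP[at_ tb]; have /andP[h _] := piece_itv n at_.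
have := le_trans h tb; rewrite -lerBrDl -(meshMn n) ler_pM2r ?mesh_gt0//.
by rewrite ler_nat.
Qed.

Lemma node_in n i : a <= node n i <= b.
Proof.
rewrite /node; case: ifP => [ni|_]; last by rewrite lexx ltW.
rewrite lerDl mulr_ge0 ?addr_ge0 ?(ltW (mesh_gt0 _))//=.
rewrite -lerBrDl -(meshMn n) ler_pM2r ?mesh_gt0//.
have : i%:R <= n%:R :> R by rewrite ler_nat.
rewrite -[n.+1%:R]natr1; lra.
Qed.

Lemma node_dist n t : G t -> `|node n (piece n t) - t| <= mesh n.
Proof.
rewrite /= in_itv/= => /andP[at_ tb].
have s0 := mesh_gt0 n; have := piece_itv n at_; set i := piece n t.
rewrite /node -[i.+1%:R]natr1 !mulrDl mul1r => /andP[h1 h2].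
case: (leqP i n) => ni; last first.
  rewrite ger0_norm ?subr_ge0//; move: h1.
  have : n.+1%:R * mesh n <= i%:R * mesh n by rewrite ler_pM2r// ler_nat.
  rewrite meshMn; lra.
by rewrite ler_norml; apply/andP; split; lra.
Qed.

Lemma fibre_piece n i : G `&` piece n @^-1` [set i] =
  G `&` `[a + i%:R * mesh n, a + i.+1%:R * mesh n[.
Proof.
apply/seteqP; split=> t [Gt p]; split=> //; move: Gt p;
  rewrite /= !in_itv/= => /andP[at_ _].
  by move=> <-; exact: piece_itv.
by rewrite -pieceP// => /eqP.
Qed.

Lemma measurable_segment : (@wlength R idfun)^*%mu.-cara.-measurable G.
Proof. exact: caratheodory_measurable_itv. Qed.

Lemma measure_segment_lty : (mu G < +oo)%E.
Proof. by rewrite completed_lebesgue_measure_bnd ?ltry// ltW. Qed.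

Lemma finitely_valued_piece n : finitely_valued G (piece n : L -> nat).
Proof.
split.
  apply: (@sub_finite_set _ _ `I_n.+2); last exact: finite_II.
  by move=> _ [t Gt <-] /=; rewrite ltnS; exact: piece_le.
move=> i; rewrite fibre_piece.
by apply: measurableI; exact: caratheodory_measurable_itv.
Qed.

Lemma fibre_measure_piece n i :
  fibre_measure mu G (piece n) i = if (i <= n)%N then mesh n else 0.
Proof.
have s0 := mesh_gt0 n; rewrite /fibre_measure fibre_piece.
have s_le k : (k <= n)%N -> k.+1%:R * mesh n <= b - a.
  by move=> kn; rewrite -(meshMn n) ler_pM2r// ler_nat.
case: leqP => [ni|ni].
  rewrite (_ : G `&` _ = `[a + i%:R * mesh n, a + i.+1%:R * mesh n[%classic).
    rewrite -[RHS]/(fine (mesh n)%:E); congr fine.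
    apply: etrans (completed_lebesgue_measure_bnd _ _ _) _.
      by rewrite lerD2l ler_pM2r// ler_nat.
    by congr EFin; rewrite -[i.+1%:R]natr1; lra.
  apply/setIidPr => t; rewrite /= !in_itv/= => /andP[h1 h2].
  have := s_le _ ni.
  have : 0 <= i%:R * mesh n by rewrite mulr_ge0// ltW.
  by move=> *; apply/andP; split; lra.
rewrite (@subset_measure0 _ _ _ mu _ `[b, b]%classic)//.
- by apply: measurableI; exact: caratheodory_measurable_itv.
- exact: caratheodory_measurable_itv.
- move=> t [/=]; rewrite !in_itv/= => /andP[_ tb] /andP[it _].
  rewrite tb andbT; apply: le_trans it.
  have : n.+1%:R * mesh n <= i%:R * mesh n by rewrite ler_pM2r// ler_nat.
  by rewrite meshMn; lra.
- by apply: etrans (completed_lebesgue_measure_bnd _ _ (lexx b)) _; rewrite subrr.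
Qed.

End midpoint_pieces.

(** * The midpoint rule for Lipschitz functions *)
Section midpoint_rule.
Context (R : realType) (X : orderUnitFAlgType R).
Context (a b : R) (ab : a < b).
Local Notation mu := (@completed_lebesgue_measure R).
Local Notation L := (caratheodory_type (@wlength R idfun)^*%mu).
Local Notation G := (`[a, b]%classic : set L).
Local Notation e := (vunit : X).
Implicit Types (f : R -> X) (n i : nat).

Lemma simple_step n f : simple G (step a b n f : L -> X).
Proof.
apply/simpleP.
exact: (finitely_valued_comp (phi := f \o node a b n) (fun _ _ => erefl)
  (finitely_valued_piece ab n)).
Qed.

Lemma simple_integral_step n f :
  simple_integral mu G (step a b n f : L -> X) = midpoint_sum a b n f.
Proof.
rewrite (simple_integral_comp (measurable_segment a b) (measure_segment_lty ab)
  (h := piece a b n) (phi := f \o node a b n) (r := index_iota 0 n.+2)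
  (finitely_valued_piece ab n))//; last 2 first.
- exact: iota_uniq.
- by move=> t Gt; rewrite mem_index_iota ltnS (piece_le ab).
rewrite big_nat_recr//= fibre_measure_piece// ltnn scale0r addr0.
rewrite /midpoint_sum scaler_sumr !big_nat; apply: eq_bigr => i.
by rewrite ltnS => /= ni; rewrite fibre_measure_piece// ni /node ni.
Qed.

(** Lipschitz continuity for the norm whose unit ball is the order interval
    between [- e] and [e]. *)
Definition unit_lipschitz (k : R) f : Prop :=
  forall u v, a <= u -> u <= v -> v <= b ->
    vabs (f v - f u) <= (k * (v - u)) *: e.

Lemma unit_lipschitzP k f u v : unit_lipschitz k f ->
  a <= u <= b -> a <= v <= b -> vabs (f v - f u) <= (k * `|v - u|) *: e.
Proof.
move=> fL /andP[au ub] /andP[av vb]; have [uv|/ltW vu] := leP u v.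
  by rewrite ger0_norm ?subr_ge0// fL.
by rewrite vabsB distrC ger0_norm ?subr_ge0// fL.
Qed.

Variable F : set_system nat.
Hypothesis hF : free_filter F.

(** The step functions at the midpoints converge uniformly, at the rate of the
    mesh; hence the midpoint sums converge to the integral at this rate. *)
Lemma pos_integral_lipschitz k f : 0 < k -> unit_lipschitz k f ->
  (forall t, a <= t <= b -> 0 <= f t) ->
  exists l (M : R), [/\ 0 < M, pos_integral F mu G (f : L -> X) l &
    forall n, vabs (midpoint_sum a b n f - l G) <= (M / n.+1%:R) *: e].
Proof.
move=> k0 fL f0; have e0 : 0 <= e := vunit_ge0 X.
have ba0 : 0 < b - a by rewrite subr_gt0.
have itvG t : G t -> a <= t <= b by rewrite /= in_itv.
have aab : a <= a <= b by rewrite lexx ltW.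
have [c c0 fac] := order_unitP (f a).
pose K := c + k * (b - a); have K0 : 0 < K by rewrite addr_gt0// mulr_gt0.
have fK t : a <= t <= b -> vabs (f t) <= K *: e.
  move=> /[dup] tab /andP[at_ tb]; rewrite -[f t](subrK (f a)).
  rewrite (le_trans (vabsD _ _))// addrC /K scalerDl vlerD//.
  rewrite (le_trans (fL _ _ _ _ _))// vlerZr// ler_wpM2l ?(ltW k0)//; lra.
have C0 : 0 < k * (b - a) by rewrite mulr_gt0.
have fnf n (t : L) : G t ->
    vabs (step a b n f t - f t) <= (k * (b - a) / n.+1%:R) *: e.
  move=> Gt; rewrite (le_trans (unit_lipschitzP fL (itvG t Gt) (node_in ab n _)))//.
  by rewrite vlerZr// -mulrA ler_pM2l// (node_dist ab).
have [l hl lP] := pos_integral_uniform_limit (measurable_segment a b)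
  (measure_segment_lty ab) hF C0 K0 (fun t Gt => f0 t (itvG t Gt))
  (fun n => simple_step n f) fnf
  (fun n t _ => fK _ (node_in ab n _)).
exists l, ((fine (mu G) + 1) * (k * (b - a))); split=> // [|n].
  by rewrite mulr_gt0// ltr_wpDl// fine_ge0.
by rewrite -simple_integral_step; exact: lP.
Qed.

(** The set of nodes is symmetric about the centre, so that the midpoint rule
    only sees the sums of [f] over symmetric pairs of points. *)
Lemma midpoint_sum_double n f :
  2 *: midpoint_sum a b n f = mesh a b n *: \sum_(0 <= i < n.+1)
    (f (a + (i%:R + 2^-1) * mesh a b n) +
     f (a + b - (a + (i%:R + 2^-1) * mesh a b n))).
Proof.
rewrite /midpoint_sum scalerA mulrC -scalerA; congr (_ *: _).
rewrite scaler_nat mulr2n big_split/=; congr (_ + _).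
rewrite big_nat_rev/= !big_nat; apply: eq_bigr => i /andP[_ ni]; congr (f _).
rewrite add0n subSS natrB; last by rewrite -ltnS.
have := meshMn a b n; rewrite -[n.+1%:R]natr1; lra.
Qed.

End midpoint_rule.

(** * The inequality *)
Section hermite_hadamard.
Context (R : realType) (X : orderUnitFAlgType R).
Local Notation mu := (@completed_lebesgue_measure R).
Local Notation L := (caratheodory_type (@wlength R idfun)^*%mu).
Local Notation e := (vunit : X).
Implicit Types (a b : R) (f : R -> X).

(** The difference quotients over short intervals are bounded, being close to a
    bounded derivative; a long interval is cut into short ones. *)
Lemma uniformly_differentiable_lipschitz a b f :
  uniformly_differentiable a b f -> exists2 k, 0 < k & unit_lipschitz a b k f.
Proof.
move=> [g [[M gM] [s [del [_ [del0 _] sdel]]]]].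
have [S [ubS _]] := sdel 0%N; rewrite vmulr1 => Ss.
have [k k0 Mk] := order_unitP (s 0%N + M).
exists k => //.
have short u v : a <= u -> u < v -> v <= b -> v - u <= del 0%N ->
    vabs (f v - f u) <= (k * (v - u)) *: e.
  move=> au uv vb vud; have vu0 : 0 < v - u by rewrite subr_gt0.
  (* The difference quotient is compared with the derivative at the left end. *)
  set q := (v - u)^-1 *: (f v - f u).
  have -> : f v - f u = (v - u) *: q by rewrite scalerA mulfV ?gt_eqF// scale1r.
  rewrite vabsZ ?(ltW vu0)// [k * _]mulrC -scalerA vlerZ ?(ltW vu0)//.
  rewrite (le_trans _ Mk)// (le_trans _ (vle_abs _))//.
  rewrite -[q](subrK (g u)) (le_trans (vabsD _ _))// vlerD//.
    rewrite (le_trans _ Ss)//; apply: ubS; exists u, u, v; split=> //.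
      by rewrite lexx ltW.
    by rewrite vu0.
  by apply: gM; rewrite au (le_trans (ltW uv)).
move=> u v au; rewrite le_eqVlt => /predU1P[<- _|uv vb].
  by rewrite !subrr vabs0 mulr0 scale0r.
have vu0 : 0 < v - u by rewrite subr_gt0.
(* [N.+1] equal steps from [u] to [v] are each shorter than [del 0]. *)
pose N := Num.truncn ((v - u) / del 0%N); pose h := (v - u) / N.+1%:R.
have h0 : 0 < h by rewrite divr_gt0.
have hN : N.+1%:R * h = v - u by rewrite mulrC divfK ?pnatr_eq0.
have hdel : h <= del 0%N.
  by rewrite ler_pdivrMr// mulrC -ler_pdivrMr// ltW// truncnS_gt.
pose w i := u + i%:R * h.
have -> : f v - f u = \sum_(0 <= i < N.+1) (f (w i.+1) - f (w i)).
  by rewrite telescope_sumr// /w hN mul0r addr0 [u + _]addrC subrK.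
rewrite (le_trans (vabs_sum _ _ _))//.
have -> : (k * (v - u)) *: e = \sum_(0 <= i < N.+1) (k * h) *: e.
  by rewrite big_const_nat subn0 iter_addr_0 -scaler_nat scalerA -hN mulrCA.
rewrite !big_nat; apply: vler_sum => i /andP[_ iN].
have wS : w i.+1 - w i = h by rewrite /w -[i.+1%:R]natr1; lra.
rewrite -wS short//.
- by rewrite /w (le_trans au)// lerDl mulr_ge0// ltW.
- by rewrite -subr_gt0 wS.
- rewrite (le_trans _ vb)// /w -lerBrDl -hN ler_pM2r// ler_nat//.
- by rewrite wS.
Qed.

Lemma unit_lipschitz_pos a b k f :
  unit_lipschitz a b k f -> unit_lipschitz a b k (fun t => vsup (f t) 0).
Proof.
by move=> fL u v au uv vb; rewrite (le_trans (vpos_dist _ _))//; exact: fL.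
Qed.

Lemma unit_lipschitzN a b k f :
  unit_lipschitz a b k f -> unit_lipschitz a b k (fun t => - f t).
Proof. by move=> fL u v au uv vb; rewrite -opprD vabsN; exact: fL. Qed.

Lemma convex_on_le_symmetric a b f t : convex_on a b f -> a < t < b ->
  2 *: f ((a + b) / 2) <= f t + f (a + b - t).
Proof.
move=> fc; set m := (a + b) / 2.
have half u v : a <= u -> u < v -> v <= b -> 2 *: f ((u + v) / 2) <= f u + f v.
  move=> au uv vb; have vu0 : v - u != 0 by rewrite subr_eq0 gt_eqF.
  have um : u < (u + v) / 2 by lra.
  have mv : (u + v) / 2 < v by lra.
  have /(vlerZ (ler0n R 2)) := fc _ _ _ au um mv vb.
  rewrite scalerDr !scalerA (_ : 2 * _ / _ = 1); last by field.
  by rewrite scale1r [2 *: f u]scaler_nat mulr2n -addrA [f u + (_ - _)]addrC subrK.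
move=> /andP[at_ tb]; have [tm|mt|tm] := ltgtP t m.
- have -> : m = (t + (a + b - t)) / 2 by rewrite [t + _]addrC subrK.
  by apply: half; move: tm; rewrite /m; lra.
- have -> : m = ((a + b - t) + t) / 2 by rewrite subrK.
  by rewrite [f t + _]addrC; apply: half; move: mt; rewrite /m; lra.
- have -> : a + b - t = t by move: tm; rewrite /m; lra.
  by rewrite -tm scaler_nat mulr2n.
Qed.

(** The chord from [a] to [b] is affine, so its values at [t] and at [a + b - t]
    add up to [f a + f b]. *)
Lemma convex_on_ge_symmetric a b f t : convex_on a b f -> a < t < b ->
  f t + f (a + b - t) <= f a + f b.
Proof.
move=> fc /andP[at_ tb]; have ba0 : b - a != 0 by rewrite subr_eq0; lra.
have ft := fc _ _ _ (lexx a) at_ tb (lexx b).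
have at' : a < a + b - t by lra.
have tb' : a + b - t < b by lra.
have ft' := fc _ _ _ (lexx a) at' tb' (lexx b).
rewrite (le_trans (vlerD ft ft'))// addrACA !scalerA -scalerDl.
rewrite (_ : _ + _ / _ = 1); last by field.
by rewrite scale1r -addrA [f a + (_ - _)]addrC subrK.
Qed.

(** The Hermite-Hadamard inequality holds without error for every midpoint sum,
    as it holds for each symmetric pair of nodes. *)
Lemma midpoint_sum_convex a b f n : a < b -> convex_on a b f ->
  f ((a + b) / 2) <= (b - a)^-1 *: midpoint_sum a b n f /\
  (b - a)^-1 *: midpoint_sum a b n f <= 2^-1 *: (f a + f b).
Proof.
move=> ab fc; have ba0 : 0 < b - a by rewrite subr_gt0.
have s0 := mesh_gt0 ab n.
have node_in i : (i < n.+1)%N -> a < a + (i%:R + 2^-1) * mesh a b n < b.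
  move=> ni; have : (i%:R + 1) * mesh a b n <= b - a.
    by rewrite -(meshMn a b n) ler_pM2r// natr1 ler_nat.
  have : 0 <= i%:R * mesh a b n by rewrite mulr_ge0// ltW.
  by rewrite !mulrDl => *; apply/andP; split; lra.
have cst (c : X) : \sum_(0 <= i < n.+1) c = n.+1%:R *: c.
  by rewrite big_const_nat subn0 iter_addr_0 scaler_nat.
have -> : (b - a)^-1 *: midpoint_sum a b n f =
    (2^-1 * (b - a)^-1) *: (2 *: midpoint_sum a b n f).
  by move: (midpoint_sum a b n f) => s; rewrite scalerA mulrAC mulVf// mul1r.
rewrite midpoint_sum_double.
(* The weights of the rule add up to [b - a], so a constant can be written as a
   midpoint sum and compared termwise. *)
have E (c : X) : 2^-1 *: c =
    (2^-1 * (b - a)^-1) *: (mesh a b n *: \sum_(0 <= i < n.+1) c).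
  by rewrite cst !scalerA -(mulrA (2^-1 / _)) [mesh _ _ _ * _]mulrC meshMn divfK ?gt_eqF.
have w0 : 0 <= 2^-1 * (b - a)^-1 by rewrite mulr_ge0// invr_ge0 ltW.
split.
  have -> : f ((a + b) / 2) = 2^-1 *: (2 *: f ((a + b) / 2))
    by rewrite scalerA mulVf// scale1r.
  rewrite E.
  apply: vlerZ => //; apply: vlerZ; first exact: ltW.
  rewrite !big_nat; apply: vler_sum => i /andP[_ ni].
  exact: convex_on_le_symmetric fc (node_in _ ni).
rewrite E; apply: vlerZ => //; apply: vlerZ; first exact: ltW.
rewrite !big_nat; apply: vler_sum => i /andP[_ ni].
exact: convex_on_ge_symmetric fc (node_in _ ni).
Qed.

Lemma midpoint_sum_posneg a b n f :
  midpoint_sum a b n (fun t => vsup (f t) 0) -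
  midpoint_sum a b n (fun t => vsup (- f t) 0) = midpoint_sum a b n f.
Proof.
rewrite /midpoint_sum -scalerBr -sumrB; congr (_ *: _).
by apply: eq_bigr => i _; rewrite vposBneg.
Qed.

End hermite_hadamard.

(** Both parts of [f] are Lipschitz and hence integrable, with midpoint sums that
    converge to their integrals. By uniqueness the integral [I] of [f] is the
    limit of the midpoint sums of [f], whatever sequences define it. *)
Theorem theorem4p8 (R : realType) (X : orderUnitFAlgType R)
    (F : set_system nat) (hF : free_filter F) (a b : R) (hab : a < b)
    (f : R -> X) (hdiff : uniformly_differentiable a b f)
    (hconv : convex_on a b f) :
  (exists I : X,
     is_integral F completed_lebesgue_measure `[a, b] f `[a, b] I) /\
  (forall I : X,
     is_integral F completed_lebesgue_measure `[a, b] f `[a, b] I ->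
     f ((a + b) / 2) <= (b - a)^-1 *: I /\
     (b - a)^-1 *: I <= 2^-1 *: (f a + f b)).
Proof.
have [k k0 fL] := uniformly_differentiable_lipschitz hdiff.
have [lp [M [M0 hlp lpM]]] := pos_integral_lipschitz hab hF k0
  (unit_lipschitz_pos fL) (fun t _ => vsup_ger (f t) 0).
have [ln [M' [M'0 hln lnM]]] := pos_integral_lipschitz hab hF k0
  (unit_lipschitz_pos (unit_lipschitzN fL)) (fun t _ => vsup_ger (- f t) 0).
split; first by exists (lp `[a, b]%classic - ln `[a, b]%classic), lp, ln.
move=> I [lp' [ln' [hlp' hln' ->]]].
rewrite (pos_integral_unique (measurable_segment a b) (measure_segment_lty hab)
  hF hlp' hlp).
rewrite (pos_integral_unique (measurable_segment a b) (measure_segment_lty hab)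
  hF hln' hln).
set J := lp _ - ln _.
have JM n : vabs (midpoint_sum a b n f - J) <= ((M + M') / n.+1%:R) *: vunit.
  rewrite -midpoint_sum_posneg /J opprD opprK addrACA.
  rewrite (le_trans (vabsD _ _))// mulrDl scalerDl vlerD//.
  by rewrite [- _ + _]addrC vabsB.
have w0 : 0 <= (b - a)^-1 by rewrite invr_ge0 subr_ge0 ltW.
have K0 : 0 < (b - a)^-1 * (M + M') by rewrite mulr_gt0 ?addr_gt0// invr_gt0 subr_gt0.
split; apply: (vle_lim K0) => n; have [lo hi] := midpoint_sum_convex n hab hconv.
- rewrite (le_trans lo)// -mulrA -scalerA -scalerDr; apply: vlerZ => //.
  exact: vabs_dist_le.
- apply: le_trans (vlat_lerD2r _ _ _ hi); rewrite -mulrA -scalerA -scalerDr.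
  by apply: vlerZ => //; apply: vabs_dist_le; rewrite vabsB.
Qed.
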